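(* Let $X,Y\in L^\infty$ and let $\mathcal{G}\subseteq\mathcal{F}$ be a sub-$\sigma$-field. Then $D_H(\mathbb{E}[X\mid\mathcal{G}],\mathbb{E}[Y\mid\mathcal{G}])\le\|X-Y\|_\infty$.
   Context: $\mathbb{K}$ is a local field with non-archimedean absolute value $|\cdot|$ satisfying $|x|=0 \iff x=0$, $|xy|=|x||y|$, $|x+y|\le|x|\vee|y|$. $(\Omega,\mathcal{F},\mathbb{P})$ is a probability space; all (in)equalities are a.s. $L^\infty$ is the space of $\mathbb{K}$-valued random variables $X$ with $\|X\|_\infty:=\operatorname{ess\,sup}|X|<\infty$; $L^\infty(\mathcal{G})$ its $\mathcal{G}$-measurable subspace. For a non-negative real random variable $S$, $\operatorname{ess\,sup}\{S\mid\mathcal{G}\}:=\sup_{p\ge1}\mathbb{E}[S^p\mid\mathcal{G}]^{1/p}$ (usual real conditional expectation), $\|X\|_\mathcal{G}:=\operatorname{ess\,sup}\{|X|\mid\mathcal{G}\}$, and the conditional expectation is the set $\mathbb{E}[X\mid\mathcal{G}]:=\{Y\in L^\infty(\mathcal{G}): \|X-Y\|_\mathcal{G}\le\|X-Z\|_\mathcal{G}\text{ for all }Z\in L^\infty(\mathcal{G})\}$. For subsets $A,B\subseteq L^\infty$, $D_H(A,B):=\sup_{U\in A}\inf_{V\in B}\|U-V\|_\infty\vee\sup_{V\in B}\inf_{U\in A}\|V-U\|_\infty$. *)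

(* Defs.v *)
From HB Require Import structures.
From mathcomp Require Import all_boot all_order all_algebra.
From mathcomp Require Import all_classical all_reals all_analysis ess_sup_inf.
Set Implicit Arguments. Unset Strict Implicit. Unset Printing Implicit Defensive.
Import Order.TTheory GRing.Theory Num.Theory.
Import numFieldNormedType.Exports.
Local Open Scope classical_set_scope.
Local Open Scope ring_scope.

(* A local field K with non-archimedean absolute value abs : K -> R:
   absolute value axioms, ultrametric inequality, non-trivial (non-discrete)
   valuation, and local compactness (the closed unit ball is sequentially
   compact for the metric |x - y|). *)
Record local_field_abs (R : realType) (K : fieldType) (abs : K -> R) : Prop := {
  abs_ge0 : forall x, 0 <= abs x;
  abs_eq0 : forall x, abs x = 0 <-> x = 0;
  absM : forall x y, abs (x * y) = abs x * abs y;
  abs_ultra : forall x y, abs (x + y) <= Num.max (abs x) (abs y);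
  abs_nontrivial : exists x, abs x <> 0 /\ abs x <> 1;
  abs_loc_compact : forall u : nat -> K, (forall n, abs (u n) <= 1) ->
    exists (phi : nat -> nat) (l : K),
      (forall n, (phi n < phi n.+1)%N) /\
      (forall e : R, 0 < e -> exists N, forall n, (N <= n)%N -> abs (u (phi n) - l) < e)
}.

Section Defs.
Context (d : measure_display) (T : measurableType d) (R : realType)
  (P : probability T R) (K : fieldType) (abs : K -> R).

Definition kball (c : K) (r : R) : set K := [set k | abs (k - c) < r].

Definition sub_sigma_field (G : set (set T)) : Prop :=
  sigma_algebra setT G /\ G `<=` measurable.

(* K-valued G-measurable function (Borel sigma-field of K generated by balls) *)
Definition Kmeas_wrt (G : set (set T)) (X : T -> K) : Prop :=
  forall c r, G (X @^-1` kball c r).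

Definition Linf_norm (X : T -> K) : \bar R := ess_sup P (fun w => (abs (X w))%:E).

Definition Linf (G : set (set T)) : set (T -> K) :=
  [set X | Kmeas_wrt G X /\ (Linf_norm X < +oo)%E].

Definition Rmeas_wrt (G : set (set T)) (Z : T -> R) : Prop :=
  forall B : set R, measurable B -> G (Z @^-1` B).

Definition is_condexp (G : set (set T)) (S Z : T -> R) : Prop :=
  Rmeas_wrt G Z /\ P.-integrable setT (EFin \o Z) /\
  forall A, G A -> (\int[P]_(w in A) (Z w)%:E = \int[P]_(w in A) (S w)%:E)%E.

(* V is a version of ess sup{S | G} = sup_{p >= 1} E[S^p | G]^{1/p},
   computed from versions Zp of E[S^p | G], p = 1, 2, ... *)
Definition is_cond_esssup (G : set (set T)) (S : T -> R) (V : T -> \bar R) : Prop :=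
  exists Zp : nat -> T -> R,
    (forall n, is_condexp G (fun w => S w ^+ n.+1) (Zp n)) /\
    forall w, V w = ereal_sup (range (fun n : nat => (powR (Zp n w) (n.+1%:R^-1))%:E)).

Definition cond_norm_le (G : set (set T)) (X Y Z : T -> K) : Prop :=
  forall V1 V2, is_cond_esssup G (fun w => abs (X w - Y w)) V1 ->
    is_cond_esssup G (fun w => abs (X w - Z w)) V2 ->
    \forall w \ae P, (V1 w <= V2 w)%E.

Definition condE (G : set (set T)) (X : T -> K) : set (T -> K) :=
  [set Y | Linf G Y /\ forall Z, Linf G Z -> cond_norm_le G X Y Z].

Definition hausdorff (A B : set (T -> K)) : \bar R :=
  Order.max
    (ereal_sup [set ereal_inf [set Linf_norm (fun w => U w - V w) | V in B] | U in A])
    (ereal_sup [set ereal_inf [set Linf_norm (fun w => V w - U w) | U in A] | V in B]).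

End Defs.

(* Main.v *)
Require Import Defs.
From HB Require Import structures.
From mathcomp Require Import all_boot all_order all_algebra.
From mathcomp Require Import all_classical all_reals all_analysis ess_sup_inf.
From mathcomp Require Import measurable_realfun.
Set Implicit Arguments. Unset Strict Implicit. Unset Printing Implicit Defensive.
Import Order.TTheory GRing.Theory Num.Theory.
Import numFieldNormedType.Exports.
Local Open Scope classical_set_scope.
Local Open Scope ring_scope.

(** The conditional essential supremum of |S| given G is the least G-measurable
majorant of |S|, so [Y] belongs to [E[X|G]] iff every G-measurable majorant of
some [|X - Z|], with [Z] in [Linf G], is also a majorant of [|X - Y|].

By local compactness [K] is separable and complete, hence there is a
G-measurable selection [V0] of the support of the conditional law of [Y].  If
[W] is a G-measurable majorant of [|Y - Z|] then [|V0 - Z| <= W]: otherwise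
[|Y - V0| < |V0 - Z|] with positive probability on the event [|V0 - Z| > W],
and there [|Y - Z| = |V0 - Z| > W] by the ultrametric inequality.  In particular
[V0] is in [E[Y|G]].

Given [U] in [E[X|G]] and [e = ||X - Y||], let [V := V0] where [|V0 - U| <= e]
and [V := U] elsewhere.  Then [|U - V| <= e] and [V] is still in [E[Y|G]]. *)

(** * Separability, completeness and measurable distances in a local field *)

Section local_field.
Context (R : realType) (K : fieldType) (abs : K -> R) (hK : local_field_abs abs).

Lemma abs1 : abs 1 = 1.
Proof.
have n0 : abs 1 != 0.
  by apply/negP => /eqP/(abs_eq0 hK)/eqP; rewrite oner_eq0.
by apply: (mulfI n0); rewrite -(absM hK) !mulr1.
Qed.

Lemma abs0 : abs 0 = 0. Proof. exact/(abs_eq0 hK). Qed.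

Lemma absN x : abs (- x) = abs x.
Proof.
have /eqP : abs (-1) ^+ 2 = 1 by rewrite expr2 -(absM hK) mulrNN mulr1 abs1.
rewrite sqrf_eq1 => /orP[/eqP N1|/eqP N1].
  by rewrite -mulN1r (absM hK) N1 mul1r.
by have := abs_ge0 hK (-1); rewrite N1 oppr_ge0 ler10.
Qed.

Lemma absB x y : abs (x - y) = abs (y - x).
Proof. by rewrite -absN opprB. Qed.

Lemma absX x n : abs (x ^+ n) = abs x ^+ n.
Proof. by elim: n => [|n IH]; rewrite ?expr0 ?abs1// !exprS (absM hK) IH. Qed.

Lemma absV x : x != 0 -> abs x^-1 = (abs x)^-1.
Proof.
move=> x0; have ax : abs x != 0 by apply: contra_neq x0 => /(abs_eq0 hK).
by apply: (mulfI ax); rewrite -(absM hK) !mulfV// abs1.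
Qed.

Lemma abs_dist y x z : abs (x - z) <= Num.max (abs (x - y)) (abs (y - z)).
Proof. by rewrite -(subrKA y x); exact: abs_ultra. Qed.

Lemma abs_dist_le y x z r : abs (x - y) <= r -> abs (y - z) <= r -> abs (x - z) <= r.
Proof. by move=> xy yz; rewrite (le_trans (abs_dist y _ _))// ge_max xy. Qed.

Lemma abs_dist_lt y x z r : abs (x - y) < r -> abs (y - z) < r -> abs (x - z) < r.
Proof. by move=> xy yz; rewrite (le_lt_trans (abs_dist y _ _))// gt_max xy. Qed.

Lemma abs_gt1_exists : exists t, 1 < abs t.
Proof.
have [x [/eqP x0 /eqP x1]] := abs_nontrivial hK.
have [?|x1'|E] := ltgtP 1 (abs x); first by exists x.
- exists x^-1; rewrite absV; last by apply: contraNneq x0 => ->; rewrite abs0.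
  by rewrite invf_gt1// lt_neqAle eq_sym x0 abs_ge0.
- by rewrite -E eqxx in x1.
Qed.

Lemma increasing_ge_id (phi : nat -> nat) :
  (forall n, (phi n < phi n.+1)%N) -> forall n, (n <= phi n)%N.
Proof. by move=> H; elim=> // n IH; exact: leq_ltn_trans (H n). Qed.

(** Without a finite net, points could be picked greedily at mutual distance at least [e], and no
    subsequence of them would converge. *)
Lemma unit_ball_totally_bounded (e : R) : 0 < e ->
  exists s : seq K, forall x, abs x <= 1 -> exists2 c, c \in s & abs (x - c) < e.
Proof.
move=> e0; apply: contrapT => /forallNP nos.
have /choice[f fP] : forall s : seq K, exists x, abs x <= 1 /\
    forall c, c \in s -> e <= abs (x - c).
  move=> s; have /existsNP[x /not_implyP[x1 nx]] := nos s.
  exists x; split => // c cs; rewrite leNgt; apply/negP => xc.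
  by apply: nx; exists c.
pose L := fix L n := if n is m.+1 then f (L m) :: L m else [::].
pose u n := f (L n).
have uL n m : (m < n)%N -> u m \in L n.
  elim: n => // n IH; rewrite ltnS leq_eqVlt /= inE => /orP[/eqP ->|/IH ->].
    by rewrite eqxx.
  by rewrite orbT.
have [phi [l [phiS cvg]]] := abs_loc_compact hK (fun n => (fP (L n)).1).
have [N HN] := cvg e e0.
have := (fP (L (phi N.+1))).2 _ (uL _ _ (phiS N)).
rewrite leNgt => /negP; apply.
by apply: (@abs_dist_lt l); [exact: HN|rewrite absB; exact: HN].
Qed.

(** Finite nets of the unit ball of every radius 1/(k+1), multiplied by the powers of some [t] with
    |t| > 1, form a countable dense set. *)
Lemma separable : exists c : nat -> K,
  forall x r, 0 < r -> exists i, abs (x - c i) < r.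
Proof.
have [t t1] := abs_gt1_exists; have t0 : 0 < abs t by exact: lt_trans t1.
have /choice[s sP] : forall n, exists s : seq K, forall x, abs x <= 1 ->
    exists2 c, c \in s & abs (x - c) < n.+1%:R^-1.
  by move=> n; apply: unit_ball_totally_bounded; rewrite invr_gt0.
pose c (p : nat * nat * nat) := t ^+ p.1.1 * nth 0 (s p.1.2) p.2.
exists (fun n => if unpickle n is Some p then c p else 0) => x r r0.
have tn0 n : 0 < abs t ^+ n by rewrite exprn_gt0.
have [n xn] : exists n, abs x <= abs t ^+ n.
  have tV1 : `|(abs t)^-1| < 1 by rewrite ger0_norm ?invr_ge0 ?(ltW t0)// invf_lt1.
  have x1 : 0 < abs x + 1 by rewrite ltr_wpDl// abs_ge0.
  have xV : 0 < (abs x + 1)^-1 by rewrite invr_gt0.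
  have /cvgrPdist_lt/(_ _ xV)[n _ /(_ n (leqnn n))] := cvg_expr tV1.
  rewrite /= sub0r normrN exprVn ger0_norm ?invr_ge0 ?(ltW (tn0 _))//.
  rewrite ltf_pV2 ?posrE// => xn; exists n.
  by rewrite ltW// (lt_trans _ xn)// ltrDl.
(* Multiplication by [t ^+ n] scales distances by |t|^n, so the net in the unit ball has to be finer
   than [r / abs t ^+ n]. *)
have [k] := ltr_add_invr (divr_gt0 r0 (tn0 n)); rewrite add0r => kr.
have tn : t ^+ n != 0.
  by apply/negP => /eqP E; have := tn0 n; rewrite -absX E abs0 ltxx.
have [|y ys xy] := sP k (x / t ^+ n).
  by rewrite (absM hK) absV// absX ler_pdivrMr// mul1r.
exists (pickle (n, k, index y (s k))); rewrite pickleK /c/= nth_index//.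
have -> : x - t ^+ n * y = t ^+ n * (x / t ^+ n - y).
  by rewrite mulrBr mulrCA mulfV// mulr1.
rewrite (absM hK) absX.
by rewrite -ltr_pdivlMl// [ltRHS]mulrC (lt_trans xy).
Qed.

(** Subtracting the initial term moves the sequence into the unit ball, where a subsequence
    converges. The limit keeps the strict bounds because ultrametric open balls are closed. *)
Lemma nested_balls_complete (v : nat -> K) :
  (forall k l, (k <= l)%N -> abs (v l - v k) < k.+1%:R^-1) ->
  exists l, forall k, abs (l - v k) < k.+1%:R^-1.
Proof.
move=> vP; have u1 n : abs (v n - v 0%N) <= 1.
  by have := vP 0%N n (leq0n n); rewrite invr1 => /ltW.
have [phi [l [phiS cvg]]] := abs_loc_compact hK u1.
exists (l + v 0%N) => k.
have k0 : 0 < k.+1%:R^-1 :> R by rewrite invr_gt0.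
have [N HN] := cvg _ k0.
apply: (@abs_dist_lt (v (phi (maxn N k)))).
  by rewrite absB opprD addrA addrAC; apply: HN; rewrite leq_maxl.
by apply: vP; rewrite (leq_trans _ (increasing_ge_id phiS _))// leq_maxr.
Qed.

Section measurability.
Context (d : measure_display) (T : measurableType d).

(** By the ultrametric inequality, |X - Y| < r iff one ball of radius r around a point of the dense
    sequence contains both values. *)
Lemma measurable_abs_sub (X Y : T -> K) :
  Kmeas_wrt abs measurable X -> Kmeas_wrt abs measurable Y ->
  measurable_fun setT (fun w => abs (X w - Y w)).
Proof.
have [c cP] := separable => mX mY.
apply: (measurability _ (RGenInftyO.measurableE R)) => _ [_ [r ->] <-].
rewrite setTI [X in measurable X](_ : _ = \bigcup_i
  (X @^-1` kball abs (c i) r `&` Y @^-1` kball abs (c i) r)).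
  by apply: bigcupT_measurable => i; exact: measurableI.
apply/seteqP; split => w /=; rewrite in_itv/=.
  move=> XYr; have r0 : 0 < r by apply: le_lt_trans XYr; exact: abs_ge0.
  have [i Xi] := cP (X w) r r0; exists i => //; split => //.
  by rewrite /kball/=; apply: (@abs_dist_lt (X w)) => //; rewrite absB.
by move=> [i _ [Xi Yi]]; apply: (@abs_dist_lt (c i)) => //; rewrite absB.
Qed.

End measurability.
End local_field.

(** * Real conditional expectations, conditional essential suprema and hulls of events *)

Lemma expr_powRV (R : realType) (x : R) n : 0 <= x ->
  (x ^+ n.+1) `^ n.+1%:R^-1 = x.
Proof. by move=> x0; rewrite -powR_mulrn// -powRrM mulfV ?pnatr_eq0// powRr1. Qed.

Lemma powRV_expr (R : realType) (x : R) n : 0 <= x ->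
  (x `^ n.+1%:R^-1) ^+ n.+1 = x.
Proof.
by move=> x0; rewrite -powR_mulrn ?powR_ge0// -powRrM mulVf ?pnatr_eq0// powRr1.
Qed.

Section conditional.
Context (d : measure_display) (T : measurableType d) (R : realType)
  (P : probability T R) (G : set (set T)) (hG : sub_sigma_field G).
Local Notation GT := (g_sigma_algebraType G).

Lemma sub_sigma_fieldE : (measurable : set (set GT)) = G.
Proof. by apply: measurable_g_measurableTypeE; case: hG. Qed.

Lemma sub_sigma_field_measurable (A : set T) : G A -> measurable A.
Proof. by case: hG => _; apply. Qed.

Lemma measurable_id_sub : measurable_fun [set: T] (id : T -> GT).
Proof.
move=> _ B mB; rewrite setTI; apply: sub_sigma_field_measurable.
by rewrite -sub_sigma_fieldE.
Qed.

Lemma Rmeas_wrtP (Z : T -> R) :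
  Rmeas_wrt G Z <-> measurable_fun [set: GT] (Z : GT -> R).
Proof.
split => [mZ _ B mB|mZ B mB]; first by rewrite setTI sub_sigma_fieldE; exact: mZ.
by rewrite -sub_sigma_fieldE -[_ @^-1` _]setTI; exact: mZ.
Qed.

Lemma Rmeas_wrt_measurable (Z : T -> R) : Rmeas_wrt G Z -> measurable_fun [set: T] Z.
Proof.
by move=> mZ _ B mB; rewrite setTI; exact/sub_sigma_field_measurable/mZ.
Qed.


(** Radon-Nikodym on the coarser space [GT]: the identity pushes [P] and the charge with density [S]
    forward to [mu] and [nu], and the density of [nu] is [G]-measurable by construction. *)
Lemma condexp_exists (S : T -> R) : P.-integrable setT (EFin \o S) ->
  exists Z, is_condexp P G S Z.
Proof.
move=> intS; have mid := measurable_id_sub.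
pose idG : {mfun T >-> GT} := HB.pack (id : T -> GT) 
  (isMeasurableFun.Build _ _ _ _ (id : T -> GT) mid).
pose mu := distribution P idG.
pose nu : {charge set GT -> \bar R} :=
  measure_function_pushforward__canonical__charge_Charge (induced_charge intS) mid.
have numu : nu `<< mu.
  apply/null_content_dominatesP => A mA muA0.
  have mTA : measurable (A : set T).
    by apply: sub_sigma_field_measurable; rewrite -sub_sigma_fieldE.
  apply: (@null_set_integral _ T _ P) => //.
  by apply: (measurable_funS measurableT) => //; exact: (measurable_int P intS).
have Dfin x := Radon_Nikodym_fin_num x numu.
have intD := Radon_Nikodym_integrable numu.
have DE A (mA : measurable A) := Radon_Nikodym_integral numu mA.
set D := Radon_Nikodym nu mu in Dfin intD DE.
have mD := measurable_int _ intD.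
have intZ : P.-integrable setT (EFin \o (fine \o D)).
  apply/integrableP; split.
    apply/measurable_EFinP; apply: (Rmeas_wrt_measurable).
    apply/Rmeas_wrtP; exact: measurableT_comp.
  case/integrableP : intD => _; rewrite ge0_integral_pushforward//; last first.
    exact: measurableT_comp.
  congr (_ < _)%E; apply: eq_integral => x _ /=.
  by move: (Dfin x); case: (D x).
exists (fine \o D); split; first by apply/Rmeas_wrtP; exact: measurableT_comp.
split => // A GA.
have mA : measurable (A : set GT) by rewrite sub_sigma_fieldE.
transitivity (nu A); last by [].
rewrite DE// integral_pushforward//.
  by apply: eq_integral => x _ /=; rewrite fineK.
rewrite (_ : D \o _ = EFin \o (fine \o D)); last first.
  by apply/funext => x /=; rewrite fineK.
apply: integrableS intZ => //.
exact: sub_sigma_field_measurable.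
Qed.

Lemma Rmeas_wrt_lt (Z Z' : T -> R) : Rmeas_wrt G Z -> Rmeas_wrt G Z' ->
  G [set w | Z w < Z' w].
Proof.
move=> /Rmeas_wrtP mZ /Rmeas_wrtP mZ'; rewrite -sub_sigma_fieldE.
have := measurable_fun_ltr mZ mZ' measurableT (Y := [set true]) I.
rewrite setTI; congr (measurable _).
Qed.

(** On the event [Z' < Z] of [G], the integral of [Z] equals that of [S], hence is at most that of
    [S'], which is that of [Z']. Since [Z - Z'] is positive there, the event is null. *)
Lemma condexp_le (S S' Z Z' : T -> R) :
  measurable_fun setT S -> measurable_fun setT S' ->
  (forall w, 0 <= S w) -> (forall w, 0 <= S' w) ->
  is_condexp P G S Z -> is_condexp P G S' Z' ->
  (\forall w \ae P, S w <= S' w) -> \forall w \ae P, Z w <= Z' w.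
Proof.
move=> mS mS' S0 S'0 [mZ [intZ ZE]] [mZ' [intZ' ZE']] SS'.
pose A := [set w | Z' w < Z w].
have GA : G A by exact: Rmeas_wrt_lt.
have mA : measurable A by exact: sub_sigma_field_measurable.
have intZA : P.-integrable A (EFin \o Z) by exact: integrableS intZ.
have intZA' : P.-integrable A (EFin \o Z') by exact: integrableS intZ'.
have int0 : (\int[P]_(w in A) `|(Z w - Z' w)%:E| = 0)%E.
  apply/eqP; rewrite eq_le integral_ge0 ?andbT//.
  under eq_integral => w.
    rewrite inE => Aw.
    rewrite gee0_abs ?lee_fin ?subr_ge0 ?(ltW Aw)// EFinB.
    over.
  rewrite integralB_EFin// sube_le0 ZE// ZE'//.
  apply: ae_ge0_le_integral => //.
  - by move=> w _; rewrite lee_fin.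
  - by apply/measurable_EFinP; exact: measurable_funTS.
  - by move=> w _; rewrite lee_fin.
  - by apply/measurable_EFinP; exact: measurable_funTS.
  - by apply: filterS SS' => w Sw _; rewrite lee_fin.
have mZZ : measurable_fun A (fun w => (Z w - Z' w)%:E).
  apply/measurable_EFinP; apply: measurable_funTS; apply: measurable_funB;
  exact: Rmeas_wrt_measurable.
move/(ae_eq_integral_abs P mA mZZ): int0.
apply: filterS => w H; rewrite leNgt; apply/negP => Aw.
by move: (H Aw) => /= -[] /eqP; rewrite subr_eq0 => /eqP E; move: Aw; rewrite /A/= E ltxx.
Qed.

Lemma condexp_id (W : T -> R) : Rmeas_wrt G W -> P.-integrable setT (EFin \o W) ->
  is_condexp P G W W.
Proof. by []. Qed.

Lemma condexp_ge0 (S Z : T -> R) : measurable_fun setT S -> (forall w, 0 <= S w) ->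
  is_condexp P G S Z -> \forall w \ae P, 0 <= Z w.
Proof.
move=> mS S0 SZ; apply: (@condexp_le (cst 0) S (cst 0) Z) => //.
- apply: condexp_id; first by apply/Rmeas_wrtP; exact: measurable_cst.
  exact: integrable0.
- exact: aeW.
Qed.

Lemma ae_bounded_integrable (S : T -> R) (C : R) : measurable_fun setT S ->
  (forall w, 0 <= S w) ->
  (\forall w \ae P, S w <= C) -> P.-integrable setT (EFin \o S).
Proof.
move=> mS S0 SC; apply/integrableP; split; first exact/measurable_EFinP.
apply: (@le_lt_trans _ _ (`|C|%:E * P setT)%E).
  apply: integral_le_bound => //; first exact/measurable_EFinP.
  apply: filterS SC => w Sw _ /=; rewrite lee_fin ger0_norm//.
  by rewrite (le_trans Sw)// ler_norm.
by rewrite probability_setT mule1 ltry.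
Qed.

Lemma ae_forall_count (I : countType) (Q : I -> T -> Prop) :
  (forall i, \forall w \ae P, Q i w) -> \forall w \ae P, forall i, Q i w.
Proof.
move=> aeQ; have : \forall w \ae P, forall n i, unpickle n = Some i -> Q i w.
  apply: ae_foralln => n; case E : (unpickle n) => [i|]; last exact: aeW.
  by apply: filterS (aeQ i) => w Qw _ [<-].
by apply: filterS => w H i; apply: (H (pickle i)); rewrite pickleK.
Qed.

(** Each E[S^n | G] is at most W^n; take n-th roots. The bound [C] makes the powers of [W]
    integrable. *)
Lemma cond_esssup_le (S W : T -> R) (V : T -> \bar R) (C : R) :
  measurable_fun setT S -> (forall w, 0 <= S w) ->
  Rmeas_wrt G W -> (forall w, 0 <= W w <= C) ->
  (\forall w \ae P, S w <= W w) ->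
  is_cond_esssup P G S V -> \forall w \ae P, (V w <= (W w)%:E)%E.
Proof.
move=> mS S0 GW W0C SW [Zp [ZpE VE]].
have W0 w : 0 <= W w by case/andP: (W0C w).
have mW := Rmeas_wrt_measurable GW.
have Zge0 n : \forall w \ae P, 0 <= Zp n w.
  apply: (condexp_ge0 _ _ (ZpE n)); first exact: measurable_funX.
  by move=> w; rewrite exprn_ge0.
have Zle n : \forall w \ae P, Zp n w <= W w ^+ n.+1.
  have intW : P.-integrable setT (EFin \o (fun w => W w ^+ n.+1)).
    apply: (@ae_bounded_integrable _ (C ^+ n.+1)).
    - exact: measurable_funX.
    - by move=> w; rewrite exprn_ge0.
    - apply: aeW => w; case/andP: (W0C w) => _ WC.
      by rewrite lerXn2r// nnegrE (le_trans (W0 w)).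
  apply: (condexp_le _ _ _ _ (ZpE n) (condexp_id _ intW)).
  - exact: measurable_funX.
  - exact: measurable_funX.
  - by move=> w; rewrite exprn_ge0.
  - by move=> w; rewrite exprn_ge0.
  - by apply/Rmeas_wrtP; apply: measurable_funX; exact/Rmeas_wrtP.
  - by apply: filterS SW => w Sw; rewrite lerXn2r// nnegrE.
apply: filterS2 (ae_foralln Zge0) (ae_foralln Zle) => w Z0 ZW.
rewrite VE; apply: ge_ereal_sup => _ [n _ <-].
rewrite lee_fin -(@expr_powRV _ (W w) n)//.
by rewrite ge0_ler_powR ?nnegrE ?exprn_ge0.
Qed.

Lemma cond_esssup_ge0 (S : T -> R) (V : T -> \bar R) :
  is_cond_esssup P G S V -> forall w, (0 <= V w)%E.
Proof.
move=> [Zp [_ VE]] w; rewrite VE; apply: le_ereal_sup_tmp.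
by exists (powR (Zp 0%N w) 1%:R^-1)%:E; [exists 0%N|rewrite lee_fin powR_ge0].
Qed.

(** A Markov estimate with growing exponents: where E[S^n | G] <= r^n for all n, the event [q <= S]
    with [r < q] has probability at most (r/q)^n, which tends to 0. *)
Lemma cond_esssup_ge (S : T -> R) (V : T -> \bar R) :
  measurable_fun setT S -> (forall w, 0 <= S w) ->
  is_cond_esssup P G S V -> \forall w \ae P, ((S w)%:E <= V w)%E.
Proof.
move=> mS S0 hV; have [Zp [ZpE VE]] := hV.
have Zge0 n : \forall w \ae P, 0 <= Zp n w.
  apply: (condexp_ge0 _ _ (ZpE n)); first exact: measurable_funX.
  by move=> w; rewrite exprn_ge0.
(* For [0 <= r] this is, up to a null set, the event [V <= r], written with powers so that no roots
   enter the integrals. *)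
pose A (r : R) := \bigcap_n [set w | Zp n w <= r ^+ n.+1].
have GA r : G (A r).
  rewrite -sub_sigma_fieldE; apply: bigcapT_measurable => // n.
  rewrite [X in measurable X](_ : _ = ~` [set w | r ^+ n.+1 < Zp n w]).
    apply: measurableC; rewrite sub_sigma_fieldE; apply: Rmeas_wrt_lt.
      by apply/Rmeas_wrtP; exact: measurable_cst.
    by case: (ZpE n).
  by apply/seteqP; split => w /=; rewrite leNgt => /negP.
have mSge q : measurable [set w | q <= S w].
  rewrite -[X in measurable X]setTI.
  rewrite (_ : [set w | q <= S w] = S @^-1` `[q, +oo[%classic); last first.
    by apply/seteqP; split => w /=; rewrite in_itv/= andbT.
  by apply: mS.
have null (r q : R) : 0 <= r -> r < q -> P (A r `&` [set w | q <= S w]) = 0.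
  move=> r0 rq.
  have mA : measurable (A r) by exact: sub_sigma_field_measurable.
  set B := A r `&` _.
  have mB : measurable B by exact: measurableI.
  have q0 : 0 < q by exact: le_lt_trans rq.
  have PBfin : P B \is a fin_num by exact: fin_num_measure.
  have PB n : (fine (P B) <= (r / q) ^+ n.+1).
    rewrite expr_div_n ler_pdivlMr ?exprn_gt0// -lee_fin EFinM fineK// muleC.
    rewrite -integral_cst//.
    have mSn D : measurable_fun D (fun w => (S w ^+ n.+1)%:E).
      by apply/measurable_EFinP; apply: measurable_funTS; exact: measurable_funX.
    have Sn0 w : (0 <= (S w ^+ n.+1)%:E)%E by rewrite lee_fin exprn_ge0.
    have [_ [intZ ZE]] := ZpE n.
    apply: (@le_trans _ _ (\int[P]_(w in A r) (S w ^+ n.+1)%:E)%E).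
      apply: (@le_trans _ _ (\int[P]_(w in B) (S w ^+ n.+1)%:E)%E).
        apply: ge0_le_integral => //.
        - by move=> w _; rewrite lee_fin exprn_ge0// ltW.
        - by move=> w [_ /= qS]; rewrite lee_fin lerXn2r// nnegrE// ltW.
      by apply: ge0_subset_integral => // w [].
    rewrite -ZE//; apply: (@le_trans _ _ (\int[P]_(w in A r) (cst (r ^+ n.+1)%:E w))%E).
      apply: le_integral => //.
      - exact: integrableS intZ.
      - by apply: finite_measure_integrable_cst.
      - by move=> w; rewrite inE => /(_ n I) /=; rewrite lee_fin.
    rewrite integral_cst// -[leRHS]mule1 lee_wpmul2l ?lee_fin ?exprn_ge0//.
    exact: probability_le1.
  have : fine (P B) <= 0.
    have rq1 : `|r / q| < 1.
      by rewrite ger0_norm ?divr_ge0 ?(ltW q0)// ltr_pdivrMr// mul1r.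
    apply/ler_addgt0Pr => e e0; rewrite add0r.
    have /cvgrPdist_lt/(_ _ e0)[N _ HN] := cvg_expr rq1.
    have := HN N.+1 (leqnSn N); rewrite /= sub0r normrN => /ltW; apply: le_trans.
    by rewrite (le_trans (PB N))// ler_norm.
  by move=> H; apply/eqP; rewrite eq_le measure_ge0 andbT -(fineK PBfin) lee_fin.
(* Rational pairs keep the exceptional set a countable union; if [V w < S w], two rationals fit in
   between. *)
have : \forall w \ae P, forall pq : rat * rat,
    0 <= (ratr pq.1 : R) -> ratr pq.1 < (ratr pq.2 : R) ->
    ~ (A (ratr pq.1) w /\ ratr pq.2 <= S w).
  apply: ae_forall_count => -[p q] /=.
  have [p0|] := boolP (0 <= ratr p :> R); last by move=> _; exact: aeW.
  have [pq|] := boolP (ratr p < ratr q :> R); last by move=> _; exact: aeW.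
  exists (A (ratr p) `&` [set w | ratr q <= S w]); split => //.
  - by apply: measurableI => //; exact: sub_sigma_field_measurable.
  - exact: null.
  - by move=> w /= /not_implyP[_ /not_implyP[_ /contrapT]].
move=> H; apply: filterS2 H (ae_foralln Zge0) => w nA Z0.
rewrite leNgt; apply/negP => VS.
have V0 := cond_esssup_ge0 hV w.
have Vfin : V w \is a fin_num by rewrite ge0_fin_numE// (lt_trans VS)// ltry.
move: VS; rewrite -(fineK Vfin) lte_fin => /[dup] VS /rat_in_itvoo[q].
rewrite in_itv/= => /andP[Vq qS].
have /rat_in_itvoo[p] := Vq; rewrite in_itv/= => /andP[Vp pq].
have p0 : 0 <= ratr p :> R by rewrite (le_trans _ (ltW Vp))// fine_ge0.
apply: (nA (p, q)) => //=; split; last exact: ltW.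
move=> n _ /=.
rewrite -[leLHS](@powRV_expr _ _ n)//.
rewrite lerXn2r ?nnegrE ?powR_ge0// (le_trans _ (ltW Vp))// -lee_fin fineK// VE.
by apply: ereal_sup_ubound; exists n.
Qed.

Lemma cond_esssup_exists (S : T -> R) (C : R) :
  measurable_fun setT S -> (forall w, 0 <= S w) ->
  (\forall w \ae P, S w <= C) -> exists V, is_cond_esssup P G S V.
Proof.
move=> mS S0 SC.
have /choice[Zp ZpE] : forall n, exists Z, is_condexp P G (fun w => S w ^+ n.+1) Z.
  move=> n; apply: condexp_exists => //.
  apply: (@ae_bounded_integrable _ (C ^+ n.+1)).
  - exact: measurable_funX.
  - by move=> w; rewrite exprn_ge0.
  - by apply: filterS SC => w SC; rewrite lerXn2r// nnegrE// (le_trans _ SC).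
by eexists; exists Zp; split => // w; reflexivity.
Qed.

(** [V] may be infinite, so it is truncated to serve as a real majorant. It is a countable supremum
    of [G]-measurable functions, the term at 0 of [esups]. *)
Lemma cond_esssup_trunc_meas (S : T -> R) (V : T -> \bar R) (C : R) :
  is_cond_esssup P G S V -> Rmeas_wrt G (fun w => fine (mine (V w) C%:E)).
Proof.
move=> [Zp [ZpE VE]]; apply/Rmeas_wrtP.
apply: (@measurableT_comp _ _ _ _ _ _ fine); first exact: fine_measurable.
apply: measurable_mine; last exact: measurable_cst.
have mf n : measurable_fun [set: GT] (fun w => ((Zp n w) `^ n.+1%:R^-1)%:E).
  apply/measurable_EFinP; apply: (measurableT_comp (measurable_powR _)).
  by apply/Rmeas_wrtP; case: (ZpE n).
have := measurable_fun_esups mf 0%N; congr (measurable_fun _ _).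
apply/funext => w; rewrite VE /esups/=; congr ereal_sup.
by apply/seteqP; split => [_ [n _ <-]|_ [n _ <-]]; exists n.
Qed.

Lemma ae_notP (A : set T) : measurable A -> (\forall w \ae P, ~ A w) <-> P A = 0.
Proof.
move=> mA; rewrite -negligibleP//; split; apply: negligibleS => w /=.
  by move=> ?; apply.
by move/contrapT.
Qed.

Lemma sub_sigma_hull (E : set T) : measurable E -> exists H : set T,
  [/\ G H, (\forall w \ae P, E w -> H w) &
   forall B, G B -> B `<=` H -> (\forall w \ae P, ~ (B w /\ E w)) ->
     \forall w \ae P, ~ B w].
Proof.
move=> mE.
have intE : P.-integrable setT (EFin \o (\1_E : T -> R)).
  apply: (@ae_bounded_integrable _ 1) => //.
  by apply: aeW => w; rewrite indicE lern1 leq_b1.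
have [Z [GZ [intZ ZE]]] := condexp_exists intE.
have G0 : Rmeas_wrt G (cst 0 : T -> R) by apply/Rmeas_wrtP; exact: measurable_cst.
pose H := [set w | 0 < Z w].
have GH : G H by exact: Rmeas_wrt_lt.
have mH := sub_sigma_field_measurable GH.
have GHC : G (~` H).
  by rewrite -sub_sigma_fieldE; apply: measurableC; rewrite sub_sigma_fieldE.
have mZ := Rmeas_wrt_measurable GZ.
exists H; split => //.
  have : P (E `&` ~` H) = 0.
    apply/eqP; rewrite eq_le measure_ge0 andbT -integral_indic//; last exact: measurableC.
    rewrite -ZE//.
    rewrite (le_trans (le_integral (g := cst 0%E) _ _ _ _))//.
    - exact: measurableC.
    - by apply: integrableS intZ => //; exact: measurableC.
    - exact: integrable0.
    - by move=> w; rewrite inE => /negP; rewrite -leNgt lee_fin.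
    - by rewrite integral0.
  move=> /ae_notP H0; have := H0 (measurableI _ _ mE (measurableC mH)).
  by apply: filterS => w nw Ew; apply: contrapT => nH; apply: nw.
move=> B GB BH BE; have mB := sub_sigma_field_measurable GB.
have PBE : P (E `&` B) = 0.
  apply/ae_notP; first exact: measurableI.
  by apply: filterS BE => w nBE [Ew Bw]; apply: nBE.
have int0 : (\int[P]_(w in B) `|(Z w)%:E| = 0)%E.
  rewrite -PBE -integral_indic// -ZE//; apply: eq_integral => w; rewrite inE => Bw.
  by rewrite gee0_abs// lee_fin ltW//; exact: BH.
have mZB : measurable_fun B (EFin \o Z).
  by apply/measurable_EFinP; exact: measurable_funTS.
move/(ae_eq_integral_abs P mB mZB): int0.
apply: filterS => w /[swap] Bw /(_ Bw) [] Zw0.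
by have := BH _ Bw; rewrite /H/= Zw0 ltxx.
Qed.

End conditional.

(** * Measurable choice of indices *)

Section index.
Context (d : measure_display) (T : measurableType d).

Lemma measurable_index (I : T -> nat) (A : nat -> set T) :
  (forall i, measurable (I @^-1` [set i])) -> (forall i, measurable (A i)) ->
  measurable [set w | A (I w) w].
Proof.
move=> mI mA; rewrite [X in measurable X](_ : _ = \bigcup_i (I @^-1` [set i] `&` A i)).
  by apply: bigcupT_measurable => i; exact: measurableI.
apply/seteqP; split => w /=; first by move=> Aw; exists (I w).
by move=> [i _ /= [-> ]].
Qed.

Lemma measurable_first_index (A : nat -> set T) : (forall i, measurable (A i)) ->
  exists I : T -> nat, (forall i, measurable (I @^-1` [set i])) /\
    forall w i, A i w -> A (I w) w.
Proof.
move=> mA; pose p w := [pred i | `[< A i w >]].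
(* The least admissible index. Where none exists the default is 0, so the event [D] below joins the
   preimage of 0. *)
pose I w := if pselect (exists i, p w i) is left e then ex_minn e else 0%N.
exists I; split => [j|w i Aw]; last first.
  rewrite /I; case: pselect => [e|[]]; last by exists i; apply/asboolP.
  by case: ex_minnP => m /asboolP.
pose D := \bigcap_i ~` A i.
have mD : measurable D by apply: bigcapT_measurable => i; exact: measurableC.
rewrite [X in measurable X](_ : _ =
  (A j `&` \bigcap_i [set w | (i < j)%N -> ~ A i w]) `|` (if j == 0%N then D else set0)).
  apply: measurableU; last by case: ifP.
  apply: measurableI => //; apply: bigcapT_measurable => i.
  have [ij|ij] := boolP (i < j)%N.
    rewrite [X in measurable X](_ : _ = ~` A i); first exact: measurableC.
    by apply/seteqP; split => w /= H //; exact: H.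
  by rewrite [X in measurable X](_ : _ = setT)//; apply/seteqP; split.
apply/seteqP; split => w /=.
  rewrite /I; case: pselect => [e|nA <-]; last first.
    by right => /= i _ Aw; apply: nA; exists i; apply/asboolP.
  case: ex_minnP => m /asboolP Am mmin <-; left; split => // i _ /= im Ai.
  by have := mmin i (asboolT Ai); rewrite leqNgt im.
move=> [[Aj nA]|].
  rewrite /I; case: pselect => [e|[]]; last by exists j; apply/asboolP.
  case: ex_minnP => m /asboolP Am /(_ j (asboolT Aj)); rewrite leq_eqVlt => /orP[/eqP//|mj].
  by have := nA m Logic.I mj.
case: eqP => // -> nA; rewrite /I; case: pselect => // e; exfalso.
by case: e => i /asboolP; exact: nA.
Qed.

End index.

(** * Conditional norms, support selections and conditional expectations of [K]-valued variables *)

Section Kvalued.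
Context (R : realType) (K : fieldType) (abs : K -> R) (hK : local_field_abs abs)
  (d : measure_display) (T : measurableType d) (P : probability T R)
  (G : set (set T)) (hG : sub_sigma_field G).
Local Notation GT := (g_sigma_algebraType G).

Lemma Kmeas_wrt_sub (X : T -> K) : Kmeas_wrt abs G X -> Kmeas_wrt abs measurable X.
Proof. by move=> mX c r; exact: (sub_sigma_field_measurable hG). Qed.

Lemma Rmeas_wrt_abs_sub (X Y : T -> K) :
  Kmeas_wrt abs G X -> Kmeas_wrt abs G Y -> Rmeas_wrt G (fun w => abs (X w - Y w)).
Proof.
move=> mX mY; apply/(Rmeas_wrtP hG).
by apply: (@measurable_abs_sub _ _ _ hK _ GT) => c r;
  rewrite (sub_sigma_fieldE hG); [exact: mX|exact: mY].
Qed.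

Lemma Kmeas_wrt_cst (c : K) : Kmeas_wrt abs G (cst c).
Proof.
move=> a r; rewrite -(sub_sigma_fieldE hG) preimage_cst.
by case: ifP => _; [exact: measurableT|exact: measurable0].
Qed.

Lemma Linf_ae_bounded (H : set (set T)) (X : T -> K) : Linf P abs H X ->
  exists2 C, 0 <= C & \forall w \ae P, abs (X w) <= C.
Proof.
move=> [_ /ess_supr_bounded[C XC]]; exists (Num.max C 0); first by rewrite le_max lexx orbT.
by apply: filterS XC => w XC; rewrite le_max XC.
Qed.

Lemma Linf_sub_ae_bounded (H H' : set (set T)) (X Y : T -> K) :
  Linf P abs H X -> Linf P abs H' Y ->
  exists2 C, 0 <= C & \forall w \ae P, abs (X w - Y w) <= C.
Proof.
move=> /Linf_ae_bounded[C C0 XC] /Linf_ae_bounded[D D0 YD].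
exists (Num.max C D); first by rewrite le_max C0.
apply: filterS2 XC YD => w XC YD; rewrite (le_trans (abs_ultra hK _ _))// (absN hK).
by rewrite ge_max !le_max XC YD orbT.
Qed.

(* Comparing conditional essential suprema amounts to comparing G-measurable
   majorants, as the conditional essential supremum is the least of these. *)
Lemma cond_norm_leP (X Y Z : T -> K) :
  Linf P abs measurable X -> Linf P abs G Y -> Linf P abs G Z ->
  cond_norm_le P abs G X Y Z <->
  forall W, Rmeas_wrt G W -> (\forall w \ae P, abs (X w - Z w) <= W w) ->
    \forall w \ae P, abs (X w - Y w) <= W w.
Proof.
move=> LX LY LZ.
have mXY : measurable_fun setT (fun w => abs (X w - Y w)).
  by apply: (measurable_abs_sub hK); [exact: LX.1|exact: Kmeas_wrt_sub LY.1].
have mXZ : measurable_fun setT (fun w => abs (X w - Z w)).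
  by apply: (measurable_abs_sub hK); [exact: LX.1|exact: Kmeas_wrt_sub LZ.1].
have XY0 w : 0 <= abs (X w - Y w) by exact: abs_ge0.
have XZ0 w : 0 <= abs (X w - Z w) by exact: abs_ge0.
have [C C0 XZC] := Linf_sub_ae_bounded LX LZ.
have [D D0 XYD] := Linf_sub_ae_bounded LX LY.
split => [le W GW XZW|le V1 V2 hV1 hV2].
  have [V1 hV1] := cond_esssup_exists hG mXY XY0 XYD.
  have [V2 hV2] := cond_esssup_exists hG mXZ XZ0 XZC.
  (* The upper estimate needs a bounded non-negative majorant. Clipping [W] to [0, C] preserves a.e.
     majorization, as |X - Z| <= C a.e. *)
  pose W' w := Num.max (Num.min (W w) C) 0.
  have V2W' : \forall w \ae P, (V2 w <= (W' w)%:E)%E.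
    apply: (cond_esssup_le hG mXZ XZ0 (C := C)) hV2.
    - apply/(Rmeas_wrtP hG); apply: measurable_maxr; last exact: measurable_cst.
      by apply: measurable_minr; [exact/(Rmeas_wrtP hG)|exact: measurable_cst].
    - by move=> w; rewrite le_max lexx orbT /= ge_max C0 andbT ge_min lexx orbT.
    - by apply: filterS2 XZW XZC => w wW wC; rewrite le_max le_min wW wC.
  have V1S := cond_esssup_ge hG mXY XY0 hV1.
  have V1V2 := le _ _ hV1 hV2.
  apply: filterS3 V1S V1V2 (filterI V2W' XZW) => w a b [c e].
  have : ((abs (X w - Y w))%:E <= (W' w)%:E)%E by rewrite (le_trans a)// (le_trans b).
  rewrite lee_fin => /le_trans; apply; rewrite ge_max ge_min lexx/=.
  exact: le_trans (XZ0 w) e.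
have V20 := cond_esssup_ge0 hV2.
(* The hypothesis is applied to the least majorant itself, cut at [C] to be real-valued. *)
pose W w := fine (mine (V2 w) C%:E).
have WE w : (W w)%:E = mine (V2 w) C%:E.
  rewrite fineK// ge0_fin_numE; last by rewrite le_min V20 lee_fin.
  by rewrite gt_min ltry orbT.
have GW : Rmeas_wrt G W by exact: cond_esssup_trunc_meas hV2.
have XYW : \forall w \ae P, abs (X w - Y w) <= W w.
  apply: le => //; apply: filterS2 (cond_esssup_ge hG mXZ XZ0 hV2) XZC => w a b.
  by rewrite -lee_fin WE le_min a lee_fin.
have := cond_esssup_le hG mXY XY0 GW (C := C) _ XYW hV1.
move=> H; apply: filterS (H _) => [w V1W|w].
  by rewrite (le_trans V1W)// WE ge_min lexx.
by rewrite -!lee_fin WE le_min V20 lee_fin C0 ge_min lexx orbT.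
Qed.

(** States that [V] lies a.e. in the support of the conditional law of [Y], without regular
    conditional laws: no non-null event of [G] confines [V] to a ball that [Y] a.s. avoids on it. *)
Definition cond_support_selection (Y V : T -> K) : Prop :=
  Kmeas_wrt abs G V /\
  forall c r B, G B -> (forall w, B w -> abs (V w - c) < r) ->
    (\forall w \ae P, ~ (B w /\ abs (Y w - c) < r)) -> \forall w \ae P, ~ B w.

(** [V] is the limit of centres of shrinking balls, chosen [G]-measurably among those that [Y] hits
    with positive conditional probability. *)
Lemma cond_support_selection_exists (Y : T -> K) : Kmeas_wrt abs measurable Y ->
  exists V, cond_support_selection Y V.
Proof.
move=> mY; have [c cP] := separable hK.
pose rad k : R := k.+1%:R^-1.
have rad0 k : 0 < rad k by rewrite invr_gt0.
have radS k l : (k <= l)%N -> rad l <= rad k.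
  by move=> kl; rewrite lef_pV2 ?posrE// ler_nat.
(* [H (k, i)] is the hull of the event that [Y] is within [rad k] of [c i], that is, where this ball
   has positive conditional probability. *)
have /choice[H HP] : forall ki : nat * nat, exists H : set T,
  [/\ G H, (\forall w \ae P, abs (Y w - c ki.2) < rad ki.1 -> H w) &
   forall B, G B -> B `<=` H -> (\forall w \ae P, ~ (B w /\ abs (Y w - c ki.2) < rad ki.1)) ->
     \forall w \ae P, ~ B w].
  by move=> [k i]; have := sub_sigma_hull P hG (mY (c i) (rad k)).
have mH k i : measurable (H (k, i) : set GT).
  by rewrite (sub_sigma_fieldE hG); case: (HP (k, i)).
(* Bundling measurability with the index maps lets [choice] produce a refinement [F] that can be
   iterated. *)
pose idx := {I : GT -> nat | forall i, measurable (I @^-1` [set i])}.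
pose near i k : set nat := [set j | abs (c j - c i) < rad k].
have mcst (Q : Prop) : measurable ([set _ | Q] : set GT).
  by have [q|q] := pselect Q; [rewrite (_ : [set _ | _] = setT)|rewrite (_ : [set _ | _] = set0)] => //;
    apply/seteqP; split.
have /choice[F FP] : forall kI : nat * idx, exists J : idx, forall w j,
    H (kI.1.+1, j) w -> near (sval kI.2 w) kI.1 j ->
    H (kI.1.+1, sval J w) w /\ near (sval kI.2 w) kI.1 (sval J w).
  move=> [k [I mI]] /=.
  have [|J [mJ JP]] := @measurable_first_index _ GT
    (fun j => H (k.+1, j) `&` [set w | near (I w) k j]).
    move=> j; apply: measurableI => //.
    by apply: (measurable_index mI (A := fun i => [set _ | near i k j])).
  by exists (exist _ J mJ) => w j Hj nj; exact: (JP w j).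
have [I0 [mI0 I0P]] := measurable_first_index (mH 0%N).
pose Ix := fix Ix k : idx := if k is m.+1 then F (m, Ix m) else exist _ I0 mI0.
pose I k := sval (Ix k).
have mI k i : measurable (I k @^-1` [set i]) := svalP (Ix k) i.
pose Good : set T := (\bigcap_k [set w | H (k, I k w) w]) `&`
  \bigcap_k [set w | near (I k w) k (I k.+1 w)].
have mGood : measurable (Good : set GT).
  apply: measurableI; apply: bigcapT_measurable => k.
    exact: (@measurable_index _ GT (I k) (fun i => H (k, i)) (mI k) (mH k)).
  apply: (@measurable_index _ GT (I k) (fun i => [set w | near i k (I k.+1 w)]) (mI k)) => i.
  exact: (@measurable_index _ GT (I k.+1) (fun j => [set _ | near i k j]) (mI k.+1)).
have YH : \forall w \ae P, forall ki : nat * nat, abs (Y w - c ki.2) < rad ki.1 -> H ki w.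
  by apply: ae_forall_count => ki; case: (HP ki).
(* Let [B] be the part of [H (k, i)] without a refining ball. If [Y] were near [c i] there, a dense
   point near [Y] would refine; so [B] is null by minimality of the hull. *)
have Hstep : \forall w \ae P, forall ki : nat * nat, H ki w ->
    exists2 j, H (ki.1.+1, j) w & near ki.2 ki.1 j.
  apply: ae_forall_count => -[k i] /=.
  pose B : set T := H (k, i) `\` \bigcup_j (H (k.+1, j) `&` [set _ | near i k j]).
  have GB : G B.
    rewrite -(sub_sigma_fieldE hG); apply: measurableD => //.
    by apply: bigcupT_measurable => j; exact: measurableI.
  have [_ _ /(_ B GB)] := HP (k, i).
  have BH : B `<=` H (k, i) by move=> w [].
  move=> /(_ BH) hB; have : \forall w \ae P, ~ B w.
    apply: hB; apply: filterS YH => w YH [[_ nB] /= Yi]; apply: nB.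
    have [j Yj] := cP (Y w) _ (rad0 k.+1); exists j => //; split; first exact: (YH (k.+1, j)).
    rewrite /near/=; apply: (abs_dist_lt hK (y := Y w)) => //.
    by rewrite (absB hK) (lt_le_trans Yj)// radS.
  move=> aenB; apply: filterS aenB => w nB Hw; apply: contrapT => nj; apply: nB.
  by split => // -[j _ [Hj nearj]]; apply: nj; exists j.
have aeGood : \forall w \ae P, Good w.
  apply: filterS2 YH Hstep => w YH step.
  have HI k : H (k, I k w) w /\ (forall m, (m < k)%N -> near (I m w) m (I m.+1 w)).
    elim: k => [|k [Hk IH]].
      split => //; have [i Yi] := cP (Y w) _ (rad0 0%N).
      by apply: (I0P w i); exact: (YH (0%N, i)).
    have [j Hj nj] := step _ Hk.
    have [H1 H2] := FP (k, Ix k) w j Hj nj.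
    split=> // m; rewrite ltnS leq_eqVlt => /orP[/eqP ->|]; [exact: H2|exact: IH].
  by split => k _ /=; [case: (HI k)|case: (HI k.+1) => _; exact].
have nested w : Good w -> forall k l, (k <= l)%N -> abs (c (I l w) - c (I k w)) < rad k.
  move=> [_ gd] k l; elim: l => [|l IH]; first by rewrite leqn0 => /eqP ->; rewrite subrr (abs0 hK).
  rewrite leq_eqVlt => /orP[/eqP ->|]; first by rewrite subrr (abs0 hK).
  rewrite ltnS => kl; apply: (abs_dist_lt hK (y := c (I l w))); last exact: IH.
  by have := gd l Logic.I; rewrite /near/= => /lt_le_trans; apply; exact: radS.
(* The limit of the nested centres on [Good], and the constant 0 elsewhere to keep [V]
   measurable. *)
have /choice[V VP] : forall w, exists v, (Good w -> forall k, abs (v - c (I k w)) < rad k) /\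
    (~ Good w -> v = 0).
  move=> w; have [gd|ngd] := pselect (Good w); last by exists 0.
  have [v vP] := nested_balls_complete hK (nested w gd).
  by exists v; split.
(* A ball of radius at least [rad k] cannot separate [V w] from [c (I k w)], so events about [V]
   become events about the countably valued [I k]. *)
have VI k w a r : Good w -> rad k <= r -> (abs (V w - a) < r <-> abs (c (I k w) - a) < r).
  move=> gd kr; have Vk : abs (V w - c (I k w)) < r := lt_le_trans ((VP w).1 gd k) kr.
  split; last by apply: (abs_dist_lt hK).
  by apply: (abs_dist_lt hK); rewrite (absB hK).
exists V; split.
  move=> a r; rewrite -(sub_sigma_fieldE hG).
  have [r0|r0] := leP r 0.
    rewrite (_ : _ @^-1` _ = set0)//; apply/seteqP; split => // w; rewrite /kball/=.
    by rewrite ltNge (le_trans r0)// abs_ge0.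
  have [k] := ltr_add_invr r0; rewrite add0r => /ltW kr.
  rewrite (_ : _ @^-1` _ = (Good `&` [set w | abs (c (I k w) - a) < r]) `|`
    (~` Good `&` [set _ | abs (0 - a) < r])); last first.
    apply/seteqP; split => w; rewrite /kball/=.
      have [gd|ngd] := pselect (Good w).
        by move/(VI k w a r gd kr); left.
      by move=> VB; right; move: VB; rewrite (VP w).2.
    by move=> [[gd]|[ngd]]; [move/(VI k w a r gd kr)|rewrite (VP w).2].
  apply: measurableU; apply: measurableI => //; last exact: measurableC.
  exact: (@measurable_index _ GT (I k) (fun i => [set _ | abs (c i - a) < r]) (mI k)).
move=> a r B GB BV BY.
have [r0|r0] := leP r 0.
  apply: aeW => w /BV; rewrite ltNge (le_trans r0)// abs_ge0//.
have [k] := ltr_add_invr r0; rewrite add0r => /ltW kr.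
(* Split [B] by the value of [I k]. If [c i] lies in the given ball, so does the whole ball of
   radius [rad k] around it, which [Y] thus avoids; otherwise the piece is empty. *)
have : \forall w \ae P, forall i, ~ (B w /\ Good w /\ I k w = i).
  apply: ae_foralln => i.
  have [ci|nci] := pselect (abs (c i - a) < r); last first.
    apply: aeW => w [Bw [gd Ii]]; apply: nci; rewrite -Ii.
    by apply/(VI k w a r gd kr); exact: BV.
  pose B' : set T := B `&` (Good `&` I k @^-1` [set i]).
  have GB' : G B'.
    rewrite -(sub_sigma_fieldE hG); apply: measurableI; last exact: measurableI.
    by rewrite (sub_sigma_fieldE hG).
  have [_ _ /(_ B' GB')] := HP (k, i); apply.
    by move=> w [_ [gd <-]]; case: gd => /(_ k Logic.I).
  apply: filterS BY => w nB [[Bw _] /= Yi]; apply: nB; split => //.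
  by apply: (abs_dist_lt hK _ ci); exact: lt_le_trans kr.
by move=> aenB; apply: filterS2 aeGood aenB => w gd nB Bw; apply: (nB (I k w)).
Qed.

(** Countably many events of [G], with [V] within 1/(k+1) of [c i] and |V - Z| > 1/(k+1), cover
    [W < |V - Z|]. On each, [Y] equally close to [c i] would give |Y - Z| >= |V - Z| > W, so each is
    null. *)
Lemma cond_support_selection_dist (Y V Z : T -> K) (W : T -> R) :
  cond_support_selection Y V -> Kmeas_wrt abs G Z -> Rmeas_wrt G W ->
  (\forall w \ae P, abs (Y w - Z w) <= W w) ->
  \forall w \ae P, abs (V w - Z w) <= W w.
Proof.
move=> [mV sV] mZ mW YZW; have [c cP] := separable hK.
have mcst (r : R) : Rmeas_wrt G (cst r) by apply/(Rmeas_wrtP hG); exact: measurable_cst.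
have : \forall w \ae P, forall ki : nat * nat,
    ~ (W w < abs (V w - Z w) /\ ki.1.+1%:R^-1 < abs (V w - Z w) /\
       abs (V w - c ki.2) < ki.1.+1%:R^-1).
  apply: ae_forall_count => -[k i] /=.
  apply: (sV (c i) k.+1%:R^-1
    [set w | W w < abs (V w - Z w) /\ k.+1%:R^-1 < abs (V w - Z w) /\
       abs (V w - c i) < k.+1%:R^-1]).
  - have mVZ := Rmeas_wrt_abs_sub mV mZ.
    have H1 := Rmeas_wrt_lt hG mW mVZ.
    have H2 := Rmeas_wrt_lt hG (mcst k.+1%:R^-1) mVZ.
    have H3 := mV (c i) k.+1%:R^-1.
    move: H1 H2 H3; rewrite -(sub_sigma_fieldE hG) => H1 H2 H3.
    exact: (measurableI _ _ H1 (measurableI _ _ H2 H3)).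
  - by move=> w [_ []].
  - apply: filterS YZW => w YZ [[WVZ [kVZ Vc]] Yc].
    have VY : abs (V w - Y w) < abs (V w - Z w).
      apply: lt_trans kVZ; apply: (abs_dist_lt hK Vc).
      by rewrite (absB hK).
    have := abs_dist hK (Y w) (V w) (Z w).
    by rewrite leNgt gt_max VY (le_lt_trans YZ).
apply: filterS2 YZW => w YZ nB; rewrite leNgt; apply/negP => WV.
have VZ0 : 0 < abs (V w - Z w).
  by apply: le_lt_trans WV; apply: le_trans YZ; exact: abs_ge0.
have [k] := ltr_add_invr VZ0; rewrite add0r => kVZ.
have [i Vi] : exists i, abs (V w - c i) < k.+1%:R^-1 by apply: cP; rewrite invr_gt0.
by apply: (nB (k, i)).
Qed.

(* Modify a selection V0 of the conditional support of Y into U wherever the two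
   are further apart than e: there every majorant of |Y - Z| exceeds e, so that U,
   which is optimal for X, is still optimal for Y. *)
Lemma condE_close (X Y U : T -> K) (e : R) :
  Linf P abs measurable X -> Linf P abs measurable Y -> condE P abs G X U ->
  (\forall w \ae P, abs (X w - Y w) <= e) ->
  exists2 V, condE P abs G Y V & \forall w \ae P, abs (U w - V w) <= e.
Proof.
move=> LX LY [LU Umin] XYe.
have [V0 sV0] := cond_support_selection_exists LY.1.
have mcst (r : R) : Rmeas_wrt G (cst r) by apply/(Rmeas_wrtP hG); exact: measurable_cst.
pose A := [set w | e < abs (V0 w - U w)].
have GA : G A by have := Rmeas_wrt_lt hG (mcst e) (Rmeas_wrt_abs_sub sV0.1 LU.1).
pose V w := if `[< A w >] then U w else V0 w.
have VA w : A w -> V w = U w by move=> Aw; rewrite /V asboolT.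
have VNA w : ~ A w -> V w = V0 w by move=> Aw; rewrite /V asboolF.
have mV : Kmeas_wrt abs G V.
  move=> c r.
  rewrite (_ : V @^-1` _ = (A `&` U @^-1` kball abs c r) `|` (~` A `&` V0 @^-1` kball abs c r)).
    have H1 := LU.1 c r; have H2 := sV0.1 c r.
    move: GA H1 H2; rewrite -(sub_sigma_fieldE hG) => H0 H1 H2.
    by apply: (measurableU _ _ (measurableI _ _ H0 H1) (measurableI _ _ (measurableC H0) H2)).
  apply/seteqP; split => w /=.
    by have [Aw|Aw] := pselect (A w); [rewrite VA//; left|rewrite VNA//; right].
  by move=> [[Aw]|[Aw]]; [rewrite VA|rewrite VNA].
have LV : Linf P abs G V.
  split => //.
  have [C C0 UC] := Linf_ae_bounded LU.
  have [D D0 YD] := Linf_ae_bounded LY.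
  (* Comparison with [Z = 0] and [W = D]: the selection inherits the bound of [Y]. *)
  have V0D : \forall w \ae P, abs (V0 w - cst 0 w) <= D.
    apply: (cond_support_selection_dist sV0 (Kmeas_wrt_cst 0) (mcst D)).
    by apply: filterS YD => w; rewrite subr0.
  apply: (@le_lt_trans _ _ (Num.max C D)%:E); last exact: ltry.
  apply/ess_supP; apply: filterS2 UC V0D => w UC; rewrite subr0 => VD.
  by rewrite lee_fin /V; case: ifP => _; rewrite le_max ?UC ?VD ?orbT.
exists V; last first.
  apply: filterS XYe => w XYe.
  have [Aw|Aw] := pselect (A w).
    by rewrite VA// subrr (abs0 hK); apply: le_trans XYe; exact: abs_ge0.
  by rewrite VNA// (absB hK) leNgt; apply/negP.
split => // Z LZ; apply/cond_norm_leP => // W mW YZW.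
(* The maximum of [W] and [e] majorizes |X - Z|, hence |X - U| by optimality of [U], and then |Y -
   U| and |V0 - U|. *)
have mWe : Rmeas_wrt G (fun w => Num.max (W w) e).
  by apply/(Rmeas_wrtP hG); apply: measurable_maxr; [exact/(Rmeas_wrtP hG)|exact: measurable_cst].
have XUW : \forall w \ae P, abs (X w - U w) <= Num.max (W w) e.
  move: (Umin Z LZ) => /cond_norm_leP; apply => //.
  apply: filterS2 XYe YZW => w XYe YZ; apply: (abs_dist_le hK (y := Y w)).
    by rewrite le_max XYe orbT.
  by rewrite le_max YZ.
have YUW : \forall w \ae P, abs (Y w - U w) <= Num.max (W w) e.
  apply: filterS2 XYe XUW => w XYe XU; apply: (abs_dist_le hK _ XU).
  by rewrite (absB hK) le_max XYe orbT.
have V0UW := cond_support_selection_dist sV0 LU.1 mWe YUW.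
have V0ZW := cond_support_selection_dist sV0 LZ.1 mW YZW.
apply: filterS3 YUW V0UW (filterI V0ZW YZW) => w YU V0U [V0Z YZ].
(* On [A], e < |V0 - U| <= max(W, e) forces e < W, so |Y - U| <= W. Off [A], the ultrametric
   inequality through [Z] bounds |Y - V0|. *)
have [Aw|Aw] := pselect (A w).
  rewrite VA//; move: YU; rewrite le_max => /orP[//|YUe].
  move: V0U; rewrite le_max => /orP[V0U|]; last by rewrite leNgt (Aw : is_true (e < _)).
  by rewrite (le_trans YUe)// (le_trans _ V0U)// ltW.
by rewrite VNA//; apply: (abs_dist_le hK YZ); rewrite (absB hK).
Qed.

End Kvalued.

(** * From a.e. estimates to the Hausdorff distance *)

Theorem mainTheorem17 (R : realType) (K : fieldType) (abs : K -> R)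
  (hK : local_field_abs abs)
  (d : measure_display) (T : measurableType d) (P : probability T R)
  (G : set (set T)) (hG : sub_sigma_field G)
  (X Y : T -> K) (hX : Linf P abs measurable X) (hY : Linf P abs measurable Y) :
  (hausdorff P abs (condE P abs G X) (condE P abs G Y) <= Linf_norm P abs (fun w => (X w - Y w)%R))%E.
Proof.
set N := Linf_norm P abs _.
have XYN : \forall w \ae P, ((abs (X w - Y w))%:E <= N)%E by exact: ess_sup_ge.
have [C C0 XYC] := Linf_sub_ae_bounded hK hX hY.
have N0 : (0 <= N)%E.
  apply: (@ess_sup_gee _ _ _ P); first by rewrite [ltRHS]probability_setT.
  by apply: aeW => w; rewrite lee_fin abs_ge0.
(* Finiteness lets [fine N] serve as the real constant [e] of [condE_close]. *)
have Nfin : N \is a fin_num.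
  rewrite ge0_fin_numE//; apply: (@le_lt_trans _ _ C%:E); last exact: ltry.
  by apply/ess_supP; apply: filterS XYC => w; rewrite lee_fin.
have XYe : \forall w \ae P, abs (X w - Y w) <= fine N.
  by apply: filterS XYN => w; rewrite -lee_fin fineK.
have YXe : \forall w \ae P, abs (Y w - X w) <= fine N.
  by apply: filterS XYe => w; rewrite (absB hK).
rewrite /hausdorff ge_max; apply/andP; split; apply: ge_ereal_sup => _ [U hU <-].
  have [V hV UV] := condE_close hK hG hX hY hU XYe.
  apply: ge_ereal_inf; exists (Linf_norm P abs (fun w => U w - V w)); first by exists V.
  by rewrite -(fineK Nfin); apply/ess_supP; apply: filterS UV => w; rewrite lee_fin.
have [V hV UV] := condE_close hK hG hY hX hU YXe.
apply: ge_ereal_inf; exists (Linf_norm P abs (fun w => U w - V w)); first by exists V.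
by rewrite -(fineK Nfin); apply/ess_supP; apply: filterS UV => w; rewrite lee_fin.
Qed.
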